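(* Let $\mathbf{k}$ be $\mathbb{R}$ or $\mathbb{C}$, let $(A,+,\sharp,\rightharpoonup,\leftharpoonup)$ be a finite dimensional complete 7-tuple over $\mathbf{k}$ with an identity $1^{\times}$, and let $G\subseteq A^{\check{-}1}$ be a $(\Delta,\Omega)$-local monoid of $A$. Define $\langle x,y\rangle := x\rightharpoonup y-y\leftharpoonup x$ and $[x,y]:=x\,\sharp\,y-y\,\sharp\,x$ for $x,y\in A$. Then the tangent-like space $T_{\Delta,\Omega}(G)=T_\Omega(G)+\sum_{\ast\in\Delta}T_\ast(G)$, with the addition $+$ of $A$, the angle bracket $\langle\,,\,\rangle$ and the square bracket $[\,,\,]$, is a real local Leibniz algebra with local part $T_\Omega(G)$ (the square bracket being the one on the local part). Moreover, the local part $T_\Omega(G)$ is a subset of the additive halo $\hbar^{+}(A)$ of $A$.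
   Context: **7-tuples.** A 7-tuple over $\mathbf{k}$ with an identity is a $\mathbf{k}$-vector space $(A,+)$ with three $\mathbf{k}$-bilinear associative operations: $\sharp$ (product), $\rightharpoonup$ (left product) and $\leftharpoonup$ (right product), satisfying the Hu-Liu triassociative law: for all $x,y,z\in A$, (1) $(x\rightharpoonup y)\,\sharp\,z=x\,\sharp\,(y\leftharpoonup z)$; (2) $(x\,\sharp\,y)\rightharpoonup z=x\,\sharp\,(y\rightharpoonup z)$; (3) $x\leftharpoonup(y\,\sharp\,z)=(x\leftharpoonup y)\,\sharp\,z$; (4) $x\rightharpoonup(y\,\sharp\,z)=x\rightharpoonup y\rightharpoonup z$; (5) $(x\,\sharp\,y)\leftharpoonup z=x\leftharpoonup y\leftharpoonup z$; together with an element $1^\times\in A$ (the identity) such that $x\,\sharp\,1^\times=x=1^\times\,\sharp\,x$ and $x\rightharpoonup 1^\times=x=1^\times\leftharpoonup x$ for all $x\in A$. The left and right products then also satisfy the diassociative law $x\rightharpoonup(y\rightharpoonup z)=x\rightharpoonup(y\leftharpoonup z)$, $(x\leftharpoonup y)\rightharpoonup z=x\leftharpoonup(y\rightharpoonup z)$, $(x\rightharpoonup y)\leftharpoonup z=(x\leftharpoonup y)\leftharpoonup z$. ''Finite dimensional complete'' means that $A$ is finite dimensional over $\mathbf{k}$ and carries a complete norm for which the three products are continuous; the topology is the usual topology of a finite dimensional vector space, and this is the topology used for differentiability. **Halos and Hu-Liu products.** The halo is $\hbar^\times(A)=\{e\in A : e\leftharpoonup x=x=x\rightharpoonup e\text{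 for all }x\in A\}$; its elements are called bar-units. The additive halo is $\hbar^+(A)=\{\alpha\in A: e\rightharpoonup\alpha=0\}$, where $e$ is a bar-unit (this does not depend on the choice of $e$). For a bar-unit $e$, the Hu-Liu product induced by $e$ is $x\bullet_e y:=x\leftharpoonup y+x\rightharpoonup y-x\leftharpoonup e\rightharpoonup y$. An element $a\in A$ is invertible if there is $b\in A$ with $a\,\sharp\,b=1^\times=b\,\sharp\,a$; $\hbar^\times(A)^{-1}$ denotes the set of invertible elements of $\hbar^\times(A)$, i.e. those elements having an inverse with respect to $\sharp$ in the monoid $(\hbar^\times(A),\sharp)$. **One-sided invertibility and diconjugation.** $A^{\check{-}1}$ is the set of $a\in A$ for which there are $y,z\in A$ with $y\rightharpoonup a=e=a\leftharpoonup z$, where $e$ is a fixed bar-unit (the set does not depend on the choice of $e$). For $a\in A^{\check{-}1}$ and such $y,z$, the diconjugation $\Psi_a:A\to A$ is $\Psi_a(x):=y\leftharpoonup x\rightharpoonup a=z\leftharpoonup x\rightharpoonup a$; it does not depend on the choices of $e,y,z$. **Local monoids.** A subset $G\subseteq A^{\check{-}1}$ is a $(\Delta,\Omega)$-local monoid of $A$ if: (i) $\Psi_a(G)\subseteq G$ for each $a\in G$; (ii) $\Delta\subseteq\{\sharp\}\cup\{\bullet_e : e\in G\cap\hbar^\times(A)\}$; (iii) if $\bullet_e\in\Delta$ then $\bullet_{\Psi_a(e)}\in\Delta$ for each $a\in G$; (iv) $(G,\ast)$ is a monoid with a unit for each $\ast\in\Delta$; (v) $\Omega\subseteq G\cap\hbar^\times(A)^{-1}$,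 $\Psi_a(\Omega)\subseteq\Omega$ for each $a\in G$, and $(\Omega,\sharp)$ is a group with identity $1^\times$. **Tangent-like space.** A differentiable curve in a subset $S\subseteq A$ is a differentiable map from an open real interval containing $0$ to $A$ with values in $S$. Define $T_\Omega(G):=\{A'(0): A(t)\text{ a differentiable curve in }\Omega\text{ with }A(0)=1^\times\}$; $T_{\bullet_e}(G):=\{a'(0): a(t)\text{ a differentiable curve in }G\text{ with }a(0)=e\}$ for $\bullet_e\in\Delta$; $T_\sharp(G):=\{a'(0): a(t)\text{ a differentiable curve in }G\text{ with }a(0)=1^\times\}$ if $\sharp\in\Delta$; $T_{\Delta,\Omega}(G):=T_\Omega(G)+\sum_{\ast\in\Delta}T_\ast(G)$. **Local Leibniz algebras.** A vector space $L$ over a field is a local Leibniz algebra with local part $L_1$ if $L_1$ is a subspace of $L$ such that: (i) there is a bilinear map $\langle\,,\,\rangle:L\times L\to L$ satisfying the (right) Leibniz identity $\langle x,\langle y,z\rangle\rangle=\langle\langle x,y\rangle,z\rangle-\langle\langle x,z\rangle,y\rangle$, together with $\langle L,L_1\rangle=0$ and $\langle L_1,L\rangle\subseteq L_1$; (ii) there is a bilinear map $[\,,\,]:L_1\times L_1\to L_1$ satisfying the Jacobi identity and $[\alpha,\beta]=-[\beta,\alpha]$; (iii) the Hu-Liu identity $\langle[\alpha,\beta],z\rangle+[\langle\beta,z\rangle,\alpha]+[\beta,\langle\alpha,z\rangle]=0$ holds for all $\alpha,\beta\in L_1$ and $z\in L$. ''Real'' means over the field $\mathbb{R}$. *)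

(* Defs.v *)
From HB Require Import structures.
From mathcomp Require Import all_boot all_order all_algebra.
From mathcomp Require Import all_classical all_reals all_analysis.
From mathcomp Require Import complex.
Set Implicit Arguments.
Unset Strict Implicit.
Unset Printing Implicit Defensive.
Import Order.TTheory GRing.Theory Num.Theory.
Import numFieldNormedType.Exports.
Local Open Scope classical_set_scope.
Local Open Scope ring_scope.

Variant scalars := RealScalars | ComplexScalars.

Definition scalar_field (R : realType) (k : scalars) : numFieldType :=
  match k with RealScalars => R | ComplexScalars => R[i] end.

Definition scalar_emb (R : realType) (k : scalars) :
    {rmorphism R -> scalar_field R k} :=
  match k return {rmorphism R -> scalar_field R k} with
  | RealScalars => idfun
  | ComplexScalars => real_complex R
  end.

(* The carrier A, viewed as an R-vector space along iota : R -> K. *)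
Definition restrict_scalars (R K : nzRingType) (iota : {rmorphism R -> K})
  (A : lmodType K) : Type := A.

Section RestrictScalars.
Variables (R K : nzRingType) (iota : {rmorphism R -> K}) (A : lmodType K).
Local Notation AR := (restrict_scalars iota A).

HB.instance Definition _ := GRing.Zmodule.copy AR A.

Let scale (r : R) (x : AR) : AR := iota r *: (x : A).

Let scaleA a b v : scale a (scale b v) = scale (a * b) v.
Proof. by rewrite /scale scalerA rmorphM. Qed.

Let scale1 : left_id 1 scale.
Proof. by move=> v; rewrite /scale rmorph1 scale1r. Qed.

Let scaleDr : right_distributive scale +%R.
Proof. by move=> a u v; rewrite /scale scalerDr. Qed.

Let scaleDl v : {morph scale^~ v : a b / a + b}.
Proof. by move=> a b; rewrite /scale rmorphD scalerDl. Qed.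

HB.instance Definition _ :=
  GRing.Zmodule_isLmodule.Build R AR scaleA scale1 scaleDr scaleDl.
End RestrictScalars.

Definition finite_dimensional (K : fieldType) (A : lmodType K) : Prop :=
  exists (n : nat) (v2r : A -> 'rV[K]_n), linear v2r /\ bijective v2r.

(* lprod and rprod are the harpoons: lprod x y is x -> y, rprod x y is x <- y. *)
Record seven_tuple (K : fieldType) (A : lmodType K) := SevenTuple {
  sharp : {bilinear A -> A -> A};
  lprod : {bilinear A -> A -> A};
  rprod : {bilinear A -> A -> A};
  tuple_one : A;
  sharpA : associative sharp;
  lprodA : associative lprod;
  rprodA : associative rprod;
  triassoc1 : forall x y z, sharp (lprod x y) z = sharp x (rprod y z);
  triassoc2 : forall x y z, lprod (sharp x y) z = sharp x (lprod y z);
  triassoc3 : forall x y z, rprod x (sharp y z) = sharp (rprod x y) z;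
  triassoc4 : forall x y z, lprod x (sharp y z) = lprod x (lprod y z);
  triassoc5 : forall x y z, rprod (sharp x y) z = rprod x (rprod y z);
  sharp_one : forall x, sharp x tuple_one = x;
  one_sharp : forall x, sharp tuple_one x = x;
  lprod_one : forall x, lprod x tuple_one = x;
  one_rprod : forall x, rprod tuple_one x = x
}.

Section Algebra.
Variables (K : fieldType) (A : lmodType K) (T : seven_tuple A).
Implicit Types (a e x y z : A) (G Om : set A) (D : set (A -> A -> A)).

Local Notation "x ♯ y" := (sharp T x y) (at level 40, left associativity).
Local Notation "x ⇀ y" := (lprod T x y) (at level 40, left associativity).
Local Notation "x ↼ y" := (rprod T x y) (at level 40, left associativity).
Local Notation "1×" := (tuple_one T).

Definition halo : set A := [set e | forall x, e ↼ x = x /\ x ⇀ e = x].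

(* The condition does not depend on the bar-unit e, and 1× is one. *)
Definition additive_halo : set A :=
  [set al | forall e, halo e -> e ⇀ al = 0].

Definition halo_inv : set A :=
  [set a | halo a /\ exists2 b, halo b & a ♯ b = 1× /\ b ♯ a = 1×].

Definition hu_liu_prod e x y : A := x ↼ y + x ⇀ y - (x ↼ e) ⇀ y.

Definition one_sided_inverses a y z : Prop :=
  exists2 e, halo e & y ⇀ a = e /\ a ↼ z = e.

Definition one_sided_inv : set A :=
  [set a | exists y z, one_sided_inverses a y z].

(* The choice of y (and of the bar-unit behind it) is immaterial. *)
Definition diconj a x : A :=
  (xget 0 [set y | exists z, one_sided_inverses a y z] ↼ x) ⇀ a.

Definition is_monoid (S : set A) (op : A -> A -> A) : Prop :=
  [/\ forall x y, S x -> S y -> S (op x y),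
      forall x y z, S x -> S y -> S z -> op x (op y z) = op (op x y) z
    & exists2 u, S u & forall x, S x -> op u x = x /\ op x u = x].

Definition is_group (S : set A) (op : A -> A -> A) (u : A) : Prop :=
  [/\ forall x y, S x -> S y -> S (op x y),
      forall x y z, S x -> S y -> S z -> op x (op y z) = op (op x y) z,
      S u,
      forall x, S x -> op u x = x /\ op x u = x
    & forall x, S x -> exists2 y, S y & op x y = u /\ op y x = u].

Record local_monoid D Om G : Prop := LocalMonoid {
  lm_sub : G `<=` one_sided_inv;
  lm_diconj : forall a x, G a -> G x -> G (diconj a x);
  lm_ops : D `<=` [set (sharp T : A -> A -> A)] `|`
                  [set hu_liu_prod e | e in G `&` halo];
  lm_ops_diconj : forall e a, halo e -> D (hu_liu_prod e) -> G a ->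
    D (hu_liu_prod (diconj a e));
  lm_monoid : forall op, D op -> is_monoid G op;
  lm_Om_sub : Om `<=` G `&` halo_inv;
  lm_Om_diconj : forall a x, G a -> Om x -> Om (diconj a x);
  lm_Om_group : is_group Om (sharp T) 1×
}.

Definition angle_bracket x y : A := x ⇀ y - y ↼ x.
Definition square_bracket x y : A := x ♯ y - y ♯ x.

End Algebra.

Section Tangent.
Variables (R : realType) (K : numFieldType) (iota : {rmorphism R -> K}).
Variables (A : normedModType K).
Implicit Types (S G Om : set A) (D : set (A -> A -> A)) (p v : A).

(* The derivative of a curve with respect to its real parameter; for K = R and
   iota = idfun it is the library notion is_derive c t 1 v. *)
Definition has_derivative (c : R -> A) (t : R) v : Prop :=
  (iota h)^-1 *: (c (h + t) - c t) @[h --> 0^'] --> v.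

Definition differentiable_curve S (I : set R) (c : R -> A) : Prop :=
  [/\ open I, is_interval I, I 0,
      forall t, I t -> S (c t)
    & forall t, I t -> exists v, has_derivative c t v].

Definition tangent_at S p : set A :=
  [set v | exists I c,
     [/\ differentiable_curve S I c, c 0 = p & has_derivative c 0 v]].

Variable T : seven_tuple A.

Definition tangent_group Om : set A := tangent_at Om (tuple_one T).

Definition tangent_op G (op : A -> A -> A) : set A :=
  [set v | (op = sharp T /\ tangent_at G (tuple_one T) v) \/
     exists2 e, halo T e /\ op = hu_liu_prod T e & tangent_at G e v].

(* The sum over D consists of the finitely supported sums. *)
Definition tangent_like D Om G : set A :=
  [set v | exists w (u : (A -> A -> A) -> A),
     [/\ tangent_group Om w,
         forall op, D op -> tangent_op G op (u op),
         finite_set [set op | D op /\ u op <> 0]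
       & v = w + \sum_(op \in D) u op]].

End Tangent.

Section LocalLeibniz.
Variables (F : fieldType) (V : lmodType F).
Implicit Types (L : set V) (f : V -> V -> V).

Definition is_subspace L : Prop :=
  L 0 /\ forall (k : F) x y, L x -> L y -> L (k *: x + y).

Definition bilinear_on L f : Prop :=
  [/\ forall x y, L x -> L y -> L (f x y),
      forall k x y z, L x -> L y -> L z ->
        f (k *: x + y) z = k *: f x z + f y z
    & forall k x y z, L x -> L y -> L z ->
        f z (k *: x + y) = k *: f z x + f z y].

(* The subspace L of V, with the restrictions of ang to L and of sq to L1, is a
   local Leibniz algebra with local part L1. *)
Record local_Leibniz (L L1 : set V) (ang sq : V -> V -> V) : Prop := LocalLeibniz {
  ll_space : is_subspace L;
  ll_local_space : is_subspace L1;
  ll_local_sub : L1 `<=` L;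
  ll_ang_bilinear : bilinear_on L ang;
  ll_ang_Leibniz : forall x y z, L x -> L y -> L z ->
    ang x (ang y z) = ang (ang x y) z - ang (ang x z) y;
  ll_ang_local0 : forall x al, L x -> L1 al -> ang x al = 0;
  ll_ang_local : forall al x, L1 al -> L x -> L1 (ang al x);
  ll_sq_bilinear : bilinear_on L1 sq;
  ll_sq_Jacobi : forall al be ga, L1 al -> L1 be -> L1 ga ->
    sq al (sq be ga) + sq be (sq ga al) + sq ga (sq al be) = 0;
  ll_sq_anti : forall al be, L1 al -> L1 be -> sq al be = - sq be al;
  ll_Hu_Liu : forall al be z, L1 al -> L1 be -> L z ->
    ang (sq al be) z + sq (ang be z) al + sq be (ang al z) = 0
}.

End LocalLeibniz.

(* Main.v *)
Require Import Defs.
From mathcomp Require Import all_boot all_order all_algebra.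
From mathcomp Require Import all_classical all_reals all_analysis.
From mathcomp Require complex.
Import Order.TTheory GRing.Theory Num.Theory.
Import numFieldNormedType.Exports.
Local Open Scope classical_set_scope.
Local Open Scope ring_scope.
Set Implicit Arguments.
Unset Strict Implicit.
Unset Printing Implicit Defensive.

(* A 7-tuple is the same as a unital associative algebra (A, ♯) with an
   idempotent unital endomorphism f: put f x := 1 ⇀ x, so that x ⇀ y = x ♯ f y
   and x ↼ y = f x ♯ y.  Then the halo is f^-1(1), the additive halo is ker f,
   <x, y> is the commutator [x, f y], and diconjugation by a is conjugation by
   f a; the Leibniz, Jacobi and Hu-Liu identities all say that commutators with
   a fixed element are derivations.
   For closure under the brackets: if c is a curve with c(0) = 1 and x lies in a
   real subspace V stable under x |-> c(t)^-1 x c(t), differentiating at 0 gives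
   [x, c'(0)] in V, because real subspaces of A are closed.  For <x, y> take
   c = f o a with a'(0) = y: conjugation by f(a(t)) is a diconjugation and sends
   T_{•e}(G) into T_{•e'}(G), where e' is the diconjugate of e. *)

(** Treats both scalar fields at once. The second field says that nonnegative elements of [K] are
    real, so every positive epsilon of [K] is the image of a positive real. *)
Record real_embedding (R : realType) (K : numFieldType)
    (iota : {rmorphism R -> K}) : Prop := RealEmbedding {
  iota_le : forall r s, (iota r <= iota s) = (r <= s);
  iota_ge0 : forall x : K, 0 <= x -> exists r, x = iota r
}.

(** * Closedness of real subspaces *)

Section RealSubspaces.
Variables (R : realType) (K : numFieldType) (iota : {rmorphism R -> K}).
Variables (iotaP : real_embedding iota) (A : normedModType K).
Implicit Types (S V : set A) (x y v w : A) (r s : R).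

Local Notation subspace S := (is_subspace (V := restrict_scalars iota A) S).

Lemma iota_lt r s : (iota r < iota s) = (r < s).
Proof. by rewrite !lt_def (iota_le iotaP) (inj_eq (fmorph_inj _)). Qed.

Lemma norm_iota r : `|iota r| = iota `|r|.
Proof.
have [r0|r0] := leP 0 r.
  by rewrite !ger0_norm // -(rmorph0 iota) (iota_le iotaP).
by rewrite !ltr0_norm ?rmorphN // -(rmorph0 iota) iota_lt.
Qed.

Lemma iota_gt0 (e : K) : 0 < e -> exists2 r, 0 < r & e = iota r.
Proof.
move=> e0; have [r er] := iota_ge0 iotaP (ltW e0).
by exists r => //; rewrite -iota_lt rmorph0 -er.
Qed.

Lemma iota_cvg0 : iota h @[h --> 0^'] --> (0 : K).
Proof.
apply/cvgr0Pnorm_lt => e /iota_gt0 [r r0 ->].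
near=> h; rewrite norm_iota iota_lt; near: h.
exact: dnbhs0_lt.
Unshelve. all: by end_near. Qed.

Lemma subspace0 S : subspace S -> S 0.
Proof. by case. Qed.

Lemma subspaceZ S : subspace S -> forall r x, S x -> S (iota r *: x).
Proof. by move=> [S0 SZ] r x Sx; have := SZ r x 0 Sx S0; rewrite addr0. Qed.

Lemma subspaceD S : subspace S -> forall x y, S x -> S y -> S (x + y).
Proof.
move=> [_ SZ] x y Sx Sy; have := SZ 1 x y Sx Sy.
by rewrite scale1r.
Qed.

Lemma subspaceN S : subspace S -> forall x, S x -> S (- x).
Proof.
move=> sS x Sx; rewrite -scaleN1r -(rmorphN1 iota).
exact: subspaceZ.
Qed.

Lemma subspaceB S : subspace S -> forall x y, S x -> S y -> S (x - y).
Proof. by move=> sS x y Sx Sy; apply: subspaceD => //; exact: subspaceN. Qed.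

(** If [v] lies outside [V], its distance to [V] is positive, which bounds the coefficient [r] by a
    multiple of the norm of [iota r *: v + w]. Along points of the sum tending to a limit the
    coefficients are therefore Cauchy in [R]. *)
Lemma closed_add_line V v : subspace V -> closed V ->
  closed [set x | exists r, exists2 w, V w & x = iota r *: v + w].
Proof.
move=> sV cV; set W := [set x | _].
have [Vv|nVv] := pselect (V v).
  suff -> : W = V by [].
  apply/seteqP; split=> [x [r [w Vw ->]]|x Vx].
    by apply: subspaceD => //; exact: subspaceZ.
  by exists 0; exists x => //; rewrite rmorph0 scale0r add0r.
(* [d] is the radius of a ball around [v] that misses [V]. *)
have [d d0 dV] : exists2 d : R, 0 < d & forall w, V w -> iota d <= `|v - w|.
  have /nbhs_ballP [e /= e0 eV] : nbhs v (~` V).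
    by apply: open_nbhs_nbhs; split=> //; exact: closed_openC.
  have [d d0 ed] := iota_gt0 e0; exists d => // w Vw.
  rewrite real_leNgt ?normr_real // -?ed ?gtr0_real //.
  by apply/negP => vw; apply: (eV w) => //; rewrite -ball_normE.
have key r w : V w -> iota (`|r| * d) <= `|iota r *: v + w|.
  move=> Vw; have [->|r0] := eqVneq r 0.
    by rewrite normr0 mul0r rmorph0.
  have ir0 : iota r != 0 by rewrite fmorph_eq0.
  have -> : iota r *: v + w = iota r *: (v - iota (- r^-1) *: w).
    rewrite scalerBr scalerA -rmorphM mulrN divff // rmorphN1.
    by rewrite scaleN1r opprK.
  rewrite normrZ norm_iota rmorphM ler_wpM2l //.
    by rewrite -(rmorph0 iota) (iota_le iotaP).
  by apply: dV; exact: subspaceZ.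
apply/closure_id/seteqP; split; first exact: subset_closure.
move=> x Wx.
pose F := within W (nbhs x).
have PF : ProperFilter F by exact: within_nbhs_proper.
(* [c y] is a coefficient of [v] in [y]; its value 0 outside [W] never matters, as [F] lives on
   [W]. *)
have /choice [c cP] : forall y, exists r, W y -> V (y - iota r *: v).
  move=> y; have [[r [w Vw ->]]|] := pselect (W y); last by exists 0.
  by exists r => _; rewrite addrC addKr.
have Fx : y @[y --> F] --> x by exact: cvg_within.
have FW : \forall y \near F, W y by exact: withinT.
have cc : cvg (c y @[y --> F]).
  apply/cauchy_cvgP/cauchy_ballP => e e0.
  (* Two points this close to [x] are less than [d * e] apart, so by [key] their coefficients differ
     by less than [e]. *)
  have de : 0 < iota (d * e / 2).
    by rewrite -(rmorph0 iota) iota_lt divr_gt0 // mulr_gt0.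
  have near1 : \forall y \near F, W y /\ `|x - y| < iota (d * e / 2).
    apply: filterI => //.
    by move/cvgrPdist_lt : Fx => /(_ _ de).
  pose P := [set y | W y /\ `|x - y| < iota (d * e / 2)].
  exists (c @` P, c @` P) => /=.
    by split; apply: filterS near1 => y Py; exists y.
  move=> [_ _] /= [[y [Wy xy] <-] [z [Wz xz] <-]].
  rewrite -ball_normE /= -(ltr_pM2r d0) -iota_lt.
  have Vyz : V ((y - iota (c y) *: v) - (z - iota (c z) *: v)).
    by apply: subspaceB => //; exact: cP.
  apply: (le_lt_trans (key _ _ Vyz)).
  have -> : iota (c y - c z) *: v + (y - iota (c y) *: v - (z - iota (c z) *: v))
          = (x - z) - (x - y).
    rewrite rmorphB scalerBl (_ : y - _ - _ = y - z - (iota (c y) *: v -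
      iota (c z) *: v)); last by rewrite !opprD addrACA.
    rewrite [LHS]addrC subrK.
    by rewrite [- (x - y)]opprB [RHS]addrC addrA subrK.
  apply: le_lt_trans (ler_normB _ _) _.
  rewrite [e * d]mulrC (splitr (d * e)) rmorphD.
  exact: ltrD.
set r := lim (c y @[y --> F]) in cc.
(* The remainders [y - iota (c y) *: v] lie in the closed [V] and converge. *)
have Vr : V (x - iota r *: v).
  apply: (@closed_cvg _ _ F _ (fun y => y - iota (c y) *: v) _ cV).
    by near=> y; apply: cP; near: y.
  apply: cvgB => //; apply: cvgZr_tmp.
  apply/cvgrPdist_lt => e /iota_gt0 [s s0 ->].
  near=> y; rewrite -rmorphB norm_iota iota_lt; near: y.
  by move/cvgrPdist_lt : cc; apply.
by exists r; exists (x - iota r *: v) => //; rewrite addrC subrK.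
Unshelve. all: by end_near. Qed.

(** Induction on a finite list of real-linear functionals separating the points of [V]. The kernel
    of the first one in [V] is separated by the others, hence closed, and [V] is this kernel or the
    kernel plus a line. Continuity of the functionals is not assumed. *)
Lemma subspace_closed (I : eqType) (phi : I -> A -> R) (s : seq I) V :
    (forall i r x y, phi i (iota r *: x + y) = r * phi i x + phi i y) ->
    subspace V ->
    (forall x, V x -> (forall i, i \in s -> phi i x = 0) -> x = 0) ->
  closed V.
Proof.
move=> phiL; elim: s V => [|i s IH] V sV sepV.
  suff -> : V = [set 0]
    by apply: accessible_closed_set1; exact/hausdorff_accessible/norm_hausdorff.
  apply/seteqP; split=> [x Vx|x ->]; last exact: subspace0.
  exact: sepV.
pose V0 := V `&` [set x | phi i x = 0].
have phi0 : phi i 0 = 0.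
  by have := phiL i (-1) 0 0; rewrite scaler0 addr0 mulN1r addNr.
have sV0 : subspace V0.
  split; first by split=> //; exact: subspace0.
  move=> r x y [Vx x0] [Vy y0]; split; first exact: sV.2.
  by rewrite /= [phi i _]phiL x0 y0 mulr0 addr0.
have cV0 : closed V0.
  apply: IH => // x [Vx x0] xs; apply: sepV => // j.
  by rewrite inE => /predU1P[->//|]; exact: xs.
have [VV0|/existsNP[v /not_implyP[Vv v0]]] :=
  pselect (forall v, V v -> phi i v = 0).
  suff -> : V = V0 by [].
  by apply/seteqP; split=> [x Vx|x []//]; split => //; exact: VV0.
have -> : V = [set x | exists r, exists2 w, V0 w & x = iota r *: v + w].
  apply/seteqP; split=> [x Vx|x [r [w [Vw _] ->]]]; last exact: sV.2.
  (* This coefficient makes [phi i] vanish on [x - iota r *: v]. *)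
  pose r := phi i x / phi i v; exists r; exists (iota (- r) *: v + x).
    split; first exact: sV.2.
    by rewrite /= phiL /r mulNr divfK ?addNr //; apply/eqP.
  by rewrite rmorphN scaleNr addNKr.
exact: closed_add_line.
Qed.

End RealSubspaces.

(** * Limits through continuous bilinear maps *)

Lemma bilinear_cvg (K : numFieldType) (A : normedModType K)
    (B : {bilinear A -> A -> A}) (X : Type) (F : set_system X)
    (g g' : X -> A) (y z : A) : Filter F ->
    continuous (fun p : A * A => B p.1 p.2) ->
    g t @[t --> F] --> y -> g' t @[t --> F] --> z ->
  B (g t) (g' t) @[t --> F] --> B y z.
Proof.
move=> FF Bc gy gz.
exact: (@continuous_cvg _ _ _ _ _ (fun t => (g t, g' t))
  (fun p : A * A => B p.1 p.2) (y, z) (Bc _) (cvg_pair gy gz)).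
Qed.

(** From [d - u = B d (u - c)] and the bound [k] on [B]: once [k * |u - c|] is at most 1/2, the norm
    of [d] is at most [2 * |u|], and then the same identity sends [d - u] to 0. *)
Lemma left_inverse_cvg (K : numFieldType) (A : normedModType K)
    (B : {bilinear A -> A -> A}) (u : A) (X : Type) (F : set_system X)
    (c d : X -> A) : Filter F ->
    continuous (fun p : A * A => B p.1 p.2) -> (forall x, B x u = x) ->
    (\forall t \near F, B (d t) (c t) = u) -> c t @[t --> F] --> u ->
  d t @[t --> F] --> u.
Proof.
move=> FF Bc Bu dc /cvgrPdist_lt cu.
have [k k0 Bk] := bilinear_schwarz Bc.
apply/cvgrPdist_lt => e e0.
(* The added 1 makes division possible even when [u] is 0. *)
have D0 : 0 < 2 * (k * `|u|) + 1.
  by rewrite ltr_wpDl // !mulr_ge0 // ltW.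
near=> t.
have dE : d t - u = B (d t) (u - c t).
  by rewrite linearBr /= Bu (near dc t) //.
have kt : k * `|u - c t| <= 2^-1.
  rewrite mulrC -ler_pdivlMr //; apply: ltW; near: t; apply: cu.
  by rewrite divr_gt0.
have dle : `|d t| <= 2 * `|u|.
  have : `|d t| <= `|u| + 2^-1 * `|d t|.
    rewrite -[X in `|X| <= _](subrK u) addrC (le_trans (ler_normD _ _)) //.
    rewrite lerD2l dE (le_trans (Bk _ _)) // mulrAC.
    exact: ler_wpM2r.
  rewrite -lerBlDr -[X in X - _]mul1r -mulrBl.
  have -> : 1 - 2^-1 = 2^-1 :> K by rewrite [X in X - _](splitr 1) mul1r addrK.
  by rewrite mulrC ler_pdivrMr // mulrC.
rewrite distrC dE (le_lt_trans (Bk _ _)) //.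
have H : k * `|d t| * `|u - c t| <= (2 * (k * `|u|) + 1) * `|u - c t|.
  apply: ler_wpM2r => //; rewrite ler_wpDr //.
  by rewrite mulrCA; apply: ler_wpM2l => //; exact: ltW.
rewrite (le_lt_trans H) // mulrC -ltr_pdivlMr //; near: t; apply: cu.
by rewrite divr_gt0.
Unshelve. all: by end_near. Qed.

(** * Derivatives of curves and tangent vectors *)

Section Curves.
Variables (R : realType) (K : numFieldType) (iota : {rmorphism R -> K}).
Variables (iotaP : real_embedding iota) (A : normedModType K).
Implicit Types (S V : set A) (x y v w p : A) (r s t : R) (a b c : R -> A).

Local Notation subspace S := (is_subspace (V := restrict_scalars iota A) S).

Lemma derivative_continuous c t v : has_derivative iota c t v ->
  c (h + t) @[h --> 0^'] --> c t.
Proof.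
move=> cv.
have H : iota h *: ((iota h)^-1 *: (c (h + t) - c t)) + c t @[h --> 0^'] --> c t.
  rewrite -[X in _ --> X]add0r -[X in X + _](scale0r v).
  apply: cvgD; last exact: cvg_cst.
  by apply: cvgZ => //; exact: iota_cvg0.
apply: cvg_trans H; apply: near_eq_cvg; near=> h.
rewrite scalerA divff ?scale1r ?subrK // fmorph_eq0.
by near: h; exact: nbhs_dnbhs_neq.
Unshelve. all: by end_near. Qed.

Lemma derivative_cst x t : has_derivative iota (fun=> x) t 0.
Proof.
rewrite /has_derivative; under eq_fun do rewrite subrr scaler0.
exact: cvg_cst.
Qed.

Lemma derivativeD a b t v w :
  has_derivative iota a t v -> has_derivative iota b t w ->
  has_derivative iota (fun s => a s + b s) t (v + w).
Proof.
move=> av bw; rewrite /has_derivative.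
under eq_fun do rewrite opprD addrACA scalerDr.
exact: cvgD.
Qed.

Lemma derivativeN a t v :
  has_derivative iota a t v -> has_derivative iota (fun s => - a s) t (- v).
Proof.
move=> av; rewrite /has_derivative.
under eq_fun do rewrite -opprD scalerN.
exact: cvgN.
Qed.

Lemma derivative_bilinear (B : {bilinear A -> A -> A}) a b t v w :
  continuous (fun p : A * A => B p.1 p.2) ->
  has_derivative iota a t v -> has_derivative iota b t w ->
  has_derivative iota (fun s => B (a s) (b s)) t (B v (b t) + B (a t) w).
Proof.
move=> Bc av bw; rewrite /has_derivative.
under eq_fun => h.
  rewrite (_ : _ *: _ = B ((iota h)^-1 *: (a (h + t) - a t)) (b (h + t)) +
                        B (a t) ((iota h)^-1 *: (b (h + t) - b t))).
    over.
  by rewrite linearZr linearZl_LR /= linearBl linearBr /= -scalerDr addrA subrK.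
apply: cvgD; apply: bilinear_cvg => //.
- exact: derivative_continuous bw.
- exact: cvg_cst.
Qed.

Lemma derivative_scale_arg c r t v :
  has_derivative iota c (r * t) v ->
  has_derivative iota (fun s => c (r * s)) t (iota r *: v).
Proof.
(* For [r = 0] the map [h |-> r * h] leaves the punctured neighbourhoods of 0, so this case, a
   constant curve, is separate. *)
move=> cv; have [->|r0] := eqVneq r 0.
  rewrite rmorph0 scale0r.
  have := derivative_cst (c 0) t; apply: cvg_trans; apply: near_eq_cvg.
  by near=> h; rewrite !mul0r.
have rh : r * h @[h --> 0^'] --> (0 : R)^'.
  move=> P [e /= e0 eP]; exists (e / `|r|) => /=.
    by rewrite divr_gt0 // normr_gt0.
  move=> h; rewrite /ball_ /= sub0r normrN ltr_pdivlMr ?normr_gt0 // => he h0.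
  apply: eP; first by rewrite /ball_ /= sub0r normrN normrM mulrC.
  by rewrite mulf_neq0.
have H : iota r *: ((iota (r * h))^-1 *: (c (r * h + r * t) - c (r * t)))
    @[h --> 0^'] --> iota r *: v.
  by apply: cvgZl_tmp; apply: (cvg_comp _ _ rh cv).
apply: cvg_trans H; apply: near_eq_cvg; near=> h.
by rewrite /= rmorphM invfM scalerA mulrA divff ?fmorph_eq0 // mul1r mulrDr.
Unshelve. all: by end_near. Qed.

Lemma derivative_mem V c t v : closed V -> subspace V ->
    (\forall h \near 0^', V (c (h + t) - c t)) -> has_derivative iota c t v ->
  V v.
Proof.
move=> cV sV Vc; apply: closed_cvg cV _ _.
near=> h; rewrite -fmorphV; apply: subspaceZ => //.
by near: h.
Unshelve. all: by end_near. Qed.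

Lemma tangent_at0 S p : S p -> tangent_at iota S p 0.
Proof.
move=> Sp; exists setT, (fun=> p); split=> //; last exact: derivative_cst.
split=> //; first exact: openT.
by move=> t _; exists 0; exact: derivative_cst.
Qed.

Lemma tangent_atZ S p r v :
  tangent_at iota S p v -> tangent_at iota S p (iota r *: v).
Proof.
move=> [I [c [[oI iI I0 IS Id] c0 cv]]].
exists [set t | I (r * t)], (fun t => c (r * t)); split; last 2 first.
- by rewrite mulr0.
- by apply: derivative_scale_arg; rewrite mulr0.
split=> [|x y Ix Iy z xyz| |t It|t /Id [w cw]].
- apply: open_comp => // t _; exact: mulrl_continuous.
- case: (leP 0 r) => r0.
    apply: (iI _ _ Ix Iy); case/andP: xyz => xz zy.
    by rewrite !ler_wpM2l.
  apply: (iI _ _ Iy Ix); case/andP: xyz => xz zy.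
  by rewrite !ler_wnM2l // ltW.
- by rewrite /= mulr0.
- exact: IS.
- by exists (iota r *: w); exact: derivative_scale_arg.
Qed.

(** Multiplying two curves adds their velocities at an idempotent [p] where the derivative of [op]
    is addition. Elsewhere only differentiability is required. This serves [♯] at 1 and each Hu-Liu
    product at its [e]. *)
Lemma tangent_atD S (op : A -> A -> A) p v w :
    (forall x y, S x -> S y -> S (op x y)) -> op p p = p ->
    (forall a b t va vb,
       has_derivative iota a t va -> has_derivative iota b t vb ->
       exists2 u, has_derivative iota (fun s => op (a s) (b s)) t u &
         a t = p -> b t = p -> u = va + vb) ->
  tangent_at iota S p v -> tangent_at iota S p w -> tangent_at iota S p (v + w).
Proof.
move=> Sop opp opd [I [a [[oI iI I0 IS Id] a0 av]]].
move=> [J [b [[oJ iJ J0 JS Jd] b0 bw]]].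
exists (I `&` J), (fun s => op (a s) (b s)); split.
- split=> [|x y [Ix Jx] [Iy Jy] z xyz| |t [It Jt]|t [It Jt]].
  + exact: openI.
  + by split; [exact: iI xyz|exact: iJ xyz].
  + by split.
  + by apply: Sop; [exact: IS|exact: JS].
  + have [va ava] := Id _ It; have [vb bvb] := Jd _ Jt.
    by have [u abu _] := opd _ _ _ _ _ ava bvb; exists u.
- by rewrite a0 b0.
- by have [u abu /(_ a0 b0) <-] := opd _ _ _ _ _ av bw.
Qed.

Lemma tangent_at_map S S' (g : A -> A) p v :
    (forall c t w, has_derivative iota c t w ->
       has_derivative iota (g \o c) t (g w)) ->
    (forall x, S x -> S' (g x)) ->
  tangent_at iota S p v -> tangent_at iota S' (g p) (g v).
Proof.
move=> gd gS [I [c [[oI iI I0 IS Id] c0 cv]]].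
exists I, (g \o c); split; [|by rewrite /= c0|exact: gd].
split=> // t It; first exact/gS/IS.
by have [w cw] := Id _ It; exists (g w); exact: gd.
Qed.

Lemma tangent_near S c (I : set R) : differentiable_curve iota S I c ->
  \forall h \near 0^', S (c h).
Proof.
move=> [oI _ I0 IS _]; apply: nbhs_dnbhs; near=> h; apply: IS; near: h.
exact: open_nbhs_nbhs.
Unshelve. all: by end_near. Qed.

End Curves.

(** * Algebra of 7-tuples through the endomorphism [f] *)

Definition lproj (K : fieldType) (A : lmodType K) (T : seven_tuple A) (x : A) :=
  lprod T (tuple_one T) x.

Section SevenTuple.
Variables (K : fieldType) (A : lmodType K) (T : seven_tuple A).
Implicit Types (a e x y z : A).

Local Notation one := (tuple_one T).
Local Notation "x ♯ y" := (sharp T x y) (at level 40, left associativity).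
Local Notation f := (lproj T).

Lemma lprojB x y : f (x - y) = f x - f y.
Proof. exact: linearBr. Qed.

Lemma lprodE x y : lprod T x y = x ♯ f y.
Proof. by rewrite /lproj -triassoc2 sharp_one. Qed.

(** The first triassociative law with 1 at both ends gives [1 ⇀ x = x ↼ 1], so the same [f] governs
    both harpoons. *)
Lemma rprodE x y : rprod T x y = f x ♯ y.
Proof.
have -> : f x = rprod T x one.
  by rewrite /lproj -[RHS](one_sharp T) -triassoc1 sharp_one.
by rewrite -triassoc3 one_sharp.
Qed.

Lemma lproj1 : f one = one.
Proof. exact: lprod_one. Qed.

Lemma lprojM x y : f (x ♯ y) = f x ♯ f y.
Proof. by rewrite {1}/lproj triassoc4 lprodA lprodE. Qed.

Lemma lprojK x : f (f x) = f x.
Proof. by rewrite {1 2}/lproj lprodA [lprod _ _ (tuple_one T)]lproj1. Qed.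

Lemma haloE e : halo T e <-> f e = one.
Proof.
split=> [/(_ one)[]//|fe x].
by rewrite rprodE lprodE fe one_sharp sharp_one.
Qed.

Lemma additive_haloE x : f x = 0 -> additive_halo T x.
Proof. by move=> fx e _; rewrite lprodE fx linear0r. Qed.

Lemma hu_liu_prodE e x y :
  hu_liu_prod T e x y = f x ♯ y + x ♯ f y - f x ♯ e ♯ f y.
Proof. by rewrite /hu_liu_prod !rprodE !lprodE. Qed.

(** The value at [(1, 1)] is [1 + 1 - e], from which [e] is recovered. *)
Lemma hu_liu_prod_inj : injective (hu_liu_prod T).
Proof.
move=> e e' /(congr1 (fun op => op one one)).
by rewrite !hu_liu_prodE lproj1 !sharp_one !one_sharp => /addrI/oppr_inj.
Qed.

Lemma hu_liu_prod_sharp e : hu_liu_prod T e = sharp T -> e = one.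
Proof.
move/(congr1 (fun op => op one one)).
rewrite !hu_liu_prodE lproj1 !sharp_one !one_sharp -addrA.
by rewrite -[X in _ = X]addr0 => /addrI/eqP; rewrite subr_eq0 => /eqP.
Qed.

Lemma angle_bracketE x y : angle_bracket T x y = square_bracket T x (f y).
Proof. by rewrite /angle_bracket lprodE rprodE. Qed.

(** If [y ⇀ a] is a bar-unit, applying [f] to [y ♯ f a] gives [f y ♯ f a = 1]; so [b] is [f y]. *)
Lemma diconjE a : one_sided_inv T a -> exists2 b, b ♯ f a = one &
  diconj T a = fun x => b ♯ x ♯ f a.
Proof.
rewrite /one_sided_inv /diconj => /= ex.
(* The default value of [xget] is excluded by the one-sided invertibility of [a]. *)
case: xgetP => [y _ [z [e he [ya _]]]|none]; last first.
  by case: ex => y yP; case: (none y).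
exists (f y); last by apply/funext => x; rewrite lprodE rprodE.
by rewrite -[in X in _ ♯ X](lprojK a) -lprojM -lprodE ya; apply/haloE.
Qed.

Lemma square_bracketN x y : square_bracket T x y = - square_bracket T y x.
Proof. by rewrite [in RHS]/square_bracket opprB. Qed.

Lemma square_bracketPr k x y z : square_bracket T z (k *: x + y) =
  k *: square_bracket T z x + square_bracket T z y.
Proof.
by rewrite /square_bracket linearPr linearPl /= opprD addrACA scalerBr.
Qed.

Lemma square_bracketPl k x y z : square_bracket T (k *: x + y) z =
  k *: square_bracket T x z + square_bracket T y z.
Proof.
by rewrite square_bracketN square_bracketPr opprD -scalerN -!square_bracketN.
Qed.

Lemma square_bracketBl x y z : square_bracket T (x - y) z =
  square_bracket T x z - square_bracket T y z.
Proof. by rewrite addrC -scaleN1r square_bracketPl scaleN1r addrC. Qed.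

Lemma square_bracketNl x y : square_bracket T (- x) y = - square_bracket T x y.
Proof. by rewrite /square_bracket linearNl linearNr /= opprD. Qed.

(** Commuting with [z] is a derivation of [♯], hence of the commutator built from it. *)
Lemma square_bracket_deriv x y z : square_bracket T (square_bracket T x y) z =
  square_bracket T (square_bracket T x z) y +
  square_bracket T x (square_bracket T y z).
Proof.
have sharp_deriv a b : square_bracket T (a ♯ b) z =
    square_bracket T a z ♯ b + a ♯ square_bracket T b z.
  rewrite /square_bracket linearBl linearBr /= !sharpA.
  by rewrite [RHS]addrC addrA subrK.
rewrite [square_bracket T x y]/square_bracket square_bracketBl !sharp_deriv.
by rewrite [X in _ - X]addrC opprD addrACA.
Qed.

Lemma square_bracket_Jacobi x y z :
  square_bracket T x (square_bracket T y z) +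
  square_bracket T y (square_bracket T z x) +
  square_bracket T z (square_bracket T x y) = 0.
Proof.
rewrite [square_bracket T z (square_bracket _ _ _)]square_bracketN.
rewrite (square_bracket_deriv x y z) [square_bracket T y (_ _ z x)]square_bracketN.
rewrite [square_bracket T z x]square_bracketN square_bracketNl opprK.
by rewrite [X in X - _]addrC subrr.
Qed.

Lemma lproj_square_bracket x y :
  f (square_bracket T x y) = square_bracket T (f x) (f y).
Proof. by rewrite /square_bracket lprojB !lprojM. Qed.

(** As [f] is an idempotent endomorphism, [f] of [[y, f z]] is [[f y, f z]]; what remains is the
    derivation rule for commuting with [f z]. *)
Lemma angle_bracket_Leibniz x y z : angle_bracket T x (angle_bracket T y z) =
  angle_bracket T (angle_bracket T x y) z - angle_bracket T (angle_bracket T x z) y.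
Proof.
rewrite !angle_bracketE lproj_square_bracket lprojK.
by rewrite [in RHS]square_bracket_deriv addrC addKr.
Qed.

Lemma square_angle_Hu_Liu x y z :
  angle_bracket T (square_bracket T x y) z +
  square_bracket T (angle_bracket T y z) x +
  square_bracket T y (angle_bracket T x z) = 0.
Proof.
rewrite !angle_bracketE square_bracket_deriv -addrA.
rewrite [square_bracket T (_ _ y _) x]square_bracketN.
rewrite [square_bracket T y (_ _ x _)]square_bracketN.
by rewrite -opprD [X in _ - X]addrC subrr.
Qed.

End SevenTuple.

(** * Differentiating products and conjugations *)

Section LocalMonoid.
Variables (R : realType) (K : numFieldType) (iota : {rmorphism R -> K}).
Variables (iotaP : real_embedding iota) (A : normedModType K).
Variables (T : seven_tuple A).
Variables (sharp_cont : continuous (fun p : A * A => sharp T p.1 p.2))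
  (lprod_cont : continuous (fun p : A * A => lprod T p.1 p.2)).

Local Notation subspace S := (is_subspace (V := restrict_scalars iota A) S).
Local Notation one := (tuple_one T).
Local Notation "x ♯ y" := (sharp T x y) (at level 40, left associativity).
Local Notation f := (lproj T).
Local Notation dd := (has_derivative iota).
Implicit Types (x y z v w p : A) (t : R) (V S : set A).

Lemma derivative_sharp (a b : R -> A) t v w : dd a t v -> dd b t w ->
  dd (fun s => a s ♯ b s) t (v ♯ b t + a t ♯ w).
Proof. exact: derivative_bilinear. Qed.

Lemma derivative_lproj (a : R -> A) t v : dd a t v -> dd (fun s => f (a s)) t (f v).
Proof.
move=> av; have := derivative_bilinear iotaP lprod_cont (derivative_cst iota one t) av.
by rewrite linear0l add0r.
Qed.

Lemma derivative_conj x y (c : R -> A) t v : dd c t v ->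
  dd ((fun z => x ♯ z ♯ y) \o c) t (x ♯ v ♯ y).
Proof.
move=> cv; have := derivative_sharp (derivative_sharp
  (derivative_cst iota x t) cv) (derivative_cst iota y t).
by rewrite !linear0l !linear0r add0r addr0.
Qed.

(* The derivative at 0 of b(t) x c(t) is [x, c'(0)].  No differentiability of b
   is needed, as (b x c - x) / t = b [x, (c - 1) / t] and b tends to 1. *)
Lemma square_bracket_mem V x (b c : R -> A) v : closed V -> subspace V ->
    dd c 0 v -> c 0 = one -> V x ->
    (\forall h \near 0^', b h ♯ c h = one /\ V (b h ♯ x ♯ c h)) ->
  V (square_bracket T x v).
Proof.
move=> cV sV cv c0 Vx bc.
have c1 : c h @[h --> 0^'] --> one.
  have := derivative_continuous iotaP cv; rewrite c0.
  by under eq_fun do rewrite addr0.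
have b1 : b h @[h --> 0^'] --> one.
  apply: (@left_inverse_cvg _ _ (sharp T) one _ _ c b _ sharp_cont
    (sharp_one T) _ c1).
  by near=> h; have [] : b h ♯ c h = one /\ V (b h ♯ x ♯ c h) by near: h.
pose w h := x ♯ ((iota h)^-1 *: (c (h + 0) - c 0)) -
            ((iota h)^-1 *: (c (h + 0) - c 0)) ♯ x.
have bw : b h ♯ w h @[h --> 0^'] --> one ♯ square_bracket T x v.
  apply: bilinear_cvg => //; apply: cvgB; apply: bilinear_cvg => //; exact: cvg_cst.
rewrite -[square_bracket T x v](one_sharp T); apply: closed_cvg cV _ _ bw.
near=> h.
have [bch Vh] : b h ♯ c h = one /\ V (b h ♯ x ♯ c h) by near: h.
have -> : b h ♯ w h = (iota h)^-1 *: (b h ♯ x ♯ c h - x).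
  have -> : w h = (iota h)^-1 *: (x ♯ c h - c h ♯ x).
    rewrite /w addr0 c0 linearZr linearZl_LR /= -scalerBr linearBr linearBl /=.
    by rewrite sharp_one one_sharp opprB addrA subrK.
  by rewrite linearZr linearBr /= !sharpA bch one_sharp.
by rewrite -fmorphV; apply: (subspaceZ sV); exact: (subspaceB sV).
Unshelve. all: by end_near. Qed.

(** * The tangent-like space of a local monoid *)

Section Tangents.
Variables (sub_closed : forall V, subspace V -> closed V).
Variables (Delta : set (A -> A -> A)) (Omega G : set A).
Hypothesis monG : local_monoid T Delta Omega G.

Local Notation TO := (tangent_group iota T Omega).
Local Notation L := (tangent_like iota T Delta Omega G).

Lemma tangent_at_subspace S (op : A -> A -> A) p :
    S p -> (forall x y, S x -> S y -> S (op x y)) -> op p p = p ->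
    (forall a b t va vb, dd a t va -> dd b t vb ->
       exists2 u, dd (fun s => op (a s) (b s)) t u &
         a t = p -> b t = p -> u = va + vb) ->
  subspace (tangent_at iota S p).
Proof.
move=> Sp Sop opp opd; split; first exact: tangent_at0.
move=> r x y Sx Sy; apply: (tangent_atD Sop) => //.
exact: tangent_atZ.
Qed.

Lemma G_one : G one.
Proof.
by have [_ _ O1 _ _] := lm_Om_group monG; have [] := lm_Om_sub monG O1.
Qed.

Lemma derivative_sharp_one (a b : R -> A) t v w : dd a t v -> dd b t w ->
  exists2 u, dd (fun s => a s ♯ b s) t u &
    a t = one -> b t = one -> u = v + w.
Proof.
move=> av bw; exists (v ♯ b t + a t ♯ w); first exact: derivative_sharp.
by move=> -> ->; rewrite sharp_one one_sharp.
Qed.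

(** At [a = b = e] the terms [f v ♯ e] and [e ♯ f w] appear once with each sign and cancel, leaving
    [v + w]. *)
Lemma derivative_hu_liu_prod e (a b : R -> A) t v w : f e = one ->
  dd a t v -> dd b t w ->
  exists2 u, dd (fun s => hu_liu_prod T e (a s) (b s)) t u &
    a t = e -> b t = e -> u = v + w.
Proof.
move=> fe av bw; have fa := derivative_lproj av; have fb := derivative_lproj bw.
exists (f v ♯ b t + f (a t) ♯ w + (v ♯ f (b t) + a t ♯ f w) -
   ((f v ♯ e + f (a t) ♯ 0) ♯ f (b t) + f (a t) ♯ e ♯ f w)).
  rewrite (_ : (fun s => _) = fun s =>
    f (a s) ♯ b s + a s ♯ f (b s) - f (a s) ♯ e ♯ f (b s)); last first.
    by apply/funext => s; rewrite hu_liu_prodE.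
  have fae := derivative_sharp fa (derivative_cst iota e t).
  exact: derivativeD (derivativeD (derivative_sharp fa bw)
    (derivative_sharp av fb)) (derivativeN (derivative_sharp fae fb)).
move=> -> ->; rewrite fe !sharp_one !one_sharp addr0.
by rewrite [f v ♯ e + w]addrC [X in X - _]addrACA addrK addrC.
Qed.

Lemma tangent_group_subspace : subspace TO.
Proof.
have [Omul _ O1 _ _] := lm_Om_group monG.
apply: tangent_at_subspace Omul _ _ => //; first exact: sharp_one.
by move=> *; exact: derivative_sharp_one.
Qed.

(* The base point p is 1 for ♯ and e for •_e; the two cases can only overlap
   when they give the same p. *)
Lemma tangent_opP op : Delta op -> exists p,
  [/\ G p, tangent_op iota T G op = tangent_at iota G p,
    subspace (tangent_at iota G p) &
    forall a, G a -> exists2 op', Delta op' &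
      tangent_at iota G (diconj T a p) `<=` tangent_op iota T G op'].
Proof.
move=> Dop; have [Gmul _ _] := lm_monoid monG Dop.
case: (lm_ops monG Dop) => [opE|/= [e [Ge he] opE]].
  exists one; split.
  - exact: G_one.
  - apply/seteqP; split=> [v [[_ //]|[e [_ eop]]]|v]; last by left.
    by rewrite (@hu_liu_prod_sharp _ _ T e) // -eop.
  - apply: (tangent_at_subspace G_one Gmul); rewrite opE ?sharp_one //.
    by move=> *; exact: derivative_sharp_one.
  (* Diconjugation fixes 1 because [b ♯ f a = 1], so [op] itself serves. *)
  - move=> a Ga; exists op => // v; have [b ba ->] := diconjE (lm_sub monG Ga).
    by rewrite sharp_one ba; left.
have fe : f e = one by apply/haloE.
exists e; split=> //.
- apply/seteqP; split=> [v [[opS]|[e' [_ e'op]]]|v Gv].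
  + by rewrite -(@hu_liu_prod_sharp _ _ T e) // opE.
  + by rewrite (@hu_liu_prod_inj _ _ T e e') // opE.
  + by right; exists e.
- apply: (tangent_at_subspace Ge Gmul); rewrite -opE.
    by rewrite hu_liu_prodE fe one_sharp sharp_one addrK.
  by move=> *; exact: derivative_hu_liu_prod.
(* The diconjugate of a bar-unit is a bar-unit: [f] sends [b ♯ e ♯ f a] to
   [f b ♯ f a = f (b ♯ f a) = 1]. *)
- move=> a Ga; rewrite -opE in Dop.
  exists (hu_liu_prod T (diconj T a e));
    first exact: lm_ops_diconj monG _ _ he Dop Ga.
  move=> v Gv; right; exists (diconj T a e) => //; split=> //.
  have [b ba ->] := diconjE (lm_sub monG Ga); apply/haloE.
  by rewrite !lprojM lprojK fe sharp_one -[X in _ ♯ X]lprojK -lprojM ba lproj1.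
Qed.

Lemma tangent_op0 op : Delta op -> tangent_op iota T G op 0.
Proof. by move=> /tangent_opP[p [_ -> /subspace0]]. Qed.

(** Reduces additive statements about the whole space to its summands, since only finitely many
    terms of the sum are nonzero. *)
Lemma tangent_like_ind (P : set A) : P 0 ->
    (forall x y, P x -> P y -> P (x + y)) -> TO `<=` P ->
    (forall op, Delta op -> tangent_op iota T G op `<=` P) ->
  L `<=` P.
Proof.
move=> P0 PD PO Pop v [w [u [Ow Gu finu ->]]]; apply: (PD); first exact: PO.
rewrite fsbig_supp fsbig_finite //= big_seq; apply: big_rec => // op x.
by rewrite in_fset_set // inE => -[Dop _] Px; apply: PD => //; exact: Pop (Gu _ Dop).
Qed.

Lemma tangent_likeD x y : L x -> L y -> L (x + y).
Proof.
move=> [w [u [Ow Gu finu ->]]] [w' [u' [Ow' Gu' finu' ->]]].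
exists (w + w'), (fun op => u op + u' op); split.
- exact: subspaceD tangent_group_subspace _ _ Ow Ow'.
- move=> op Dop; have := Gu _ Dop; have := Gu' _ Dop.
  have [p [_ -> sp _]] := tangent_opP Dop.
  by move=> Gu'op Guop; exact: (subspaceD sp).
- apply: sub_finite_set (_ : finite_set ([set op | Delta op /\ u op <> 0] `|`
    [set op | Delta op /\ u' op <> 0])); last by rewrite finite_setU.
  move=> op /= [Dop uu']; have [u0|] := pselect (u op = 0); last by left.
  by right; split=> // u'0; apply: uu'; rewrite u0 u'0 addr0.
(* All three sums are taken over the union of the two supports, a finite set, where they can be
   added termwise. *)
- set X := [set op | Delta op /\ u op <> 0] in finu.
  set X' := [set op | Delta op /\ u' op <> 0] in finu'.
  have XD : X `|` X' `<=` Delta by move=> op [] [].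
  have u0 op : (Delta `\` (X `|` X')) op -> u op = 0.
    by move=> [Dop /not_orP[nX _]]; apply: contrapT => ?; apply: nX.
  have u'0 op : (Delta `\` (X `|` X')) op -> u' op = 0.
    by move=> [Dop /not_orP[_ nX]]; apply: contrapT => ?; apply: nX.
  rewrite addrACA; congr (_ + _).
  rewrite -!(fsbig_widen (X `|` X') Delta) //.
    by rewrite -fsbig_split // finite_setU.
  by move=> op Dop /=; rewrite u0 // u'0 // addr0.
Qed.

Lemma tangent_group_like : TO `<=` L.
Proof.
move=> w Ow; exists w, (fun=> 0); split=> //; first exact: tangent_op0.
  by apply: sub_finite_set (finite_set0 _) => op [].
by rewrite fsbig1 ?addr0.
Qed.

Lemma tangent_op_like op : Delta op -> tangent_op iota T G op `<=` L.
Proof.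
move=> Dop v Gv; exists 0, (fun op' => if op' == op then v else 0); split.
- exact: subspace0 tangent_group_subspace.
- by move=> op' Dop'; case: eqP => [->//|_]; exact: tangent_op0.
- apply: sub_finite_set (finite_set1 op) => op' /= [_].
  by case: eqP.
- rewrite add0r -(fsbig_widen [set op]); last 2 first.
  + by move=> _ ->.
  + by move=> op' [_ /eqP/negPf] /= ->.
  by rewrite fsbig_set1 eqxx.
Qed.

Lemma tangent_like_subspace : subspace L.
Proof.
have L0 : L 0 by apply: tangent_group_like; exact: subspace0 tangent_group_subspace.
split=> // r x y Lx Ly; apply: tangent_likeD => //.
apply: (tangent_like_ind (P := [set x | L (iota r *: x)])) Lx => /=.
- by rewrite scaler0.
- by move=> x' y' Lx Ly'; rewrite scalerDr; exact: tangent_likeD.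
- move=> w Ow /=; apply: tangent_group_like.
  exact: subspaceZ tangent_group_subspace _ _ Ow.
- move=> op Dop v /= Gv; apply: (tangent_op_like Dop); move: Gv.
  by have [p [_ -> sp _]] := tangent_opP Dop => Gv; exact: (subspaceZ sp).
Qed.

(** [Omega] consists of bar-units, so [f] is constantly 1 along the curve and its difference
    quotients lie in the closed subspace [{0}]. *)
Lemma tangent_group_lproj0 w : TO w -> f w = 0.
Proof.
move=> [I [c [cI c0 cw]]].
apply: (derivative_mem (V := [set 0]) _ _ _ (derivative_lproj cw)).
- by apply: sub_closed; split=> //= r x y -> ->; rewrite addr0; exact: scaler0.
- by split=> //= r x y -> ->; rewrite addr0; exact: scaler0.
- near=> h => /=; rewrite addr0 -lprojB.
  have Oc : Omega (c h) by near: h; exact: tangent_near cI.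
  have fO x : Omega x -> f x = one.
    by move=> /(lm_Om_sub monG)[_ []] /haloE.
  have [_ _ O1 _ _] := lm_Om_group monG.
  by rewrite lprojB (fO _ Oc) c0 lproj1 subrr.
Unshelve. all: by end_near. Qed.

Lemma diconj_tangent S S' a p v : G a ->
    (forall x, S x -> S' (diconj T a x)) ->
  tangent_at iota S p v -> tangent_at iota S' (diconj T a p) (diconj T a v).
Proof.
move=> Ga SS'; apply: tangent_at_map SS' => c t w cw.
by have [b _ ->] := diconjE (lm_sub monG Ga); exact: derivative_conj.
Qed.

Lemma angle_bracket_mem V x op y : subspace V -> Delta op -> V x ->
    (forall a, G a -> V (diconj T a x)) -> tangent_op iota T G op y ->
  V (angle_bracket T x y).
Proof.
move=> sV Dop Vx Vax; rewrite angle_bracketE => yop.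
(* Whether the base point is 1 or a bar-unit, [f] sends it to 1, so [f] composed with the curve
   passes through 1. *)
have [p [I [c [cI c0 cy]]] fp] : exists2 p, tangent_at iota G p y & f p = one.
  case: yop => [[_ Gy]|[e [/haloE fe _] Gy]]; last by exists e.
  by exists one => //; exact: lproj1.
(* Left inverses are picked pointwise, with no regularity in [h]; outside [G] the value 0 is a
   placeholder. *)
have /choice[b bP] : forall h, exists b, G (c h) ->
    b ♯ f (c h) = one /\ diconj T (c h) x = b ♯ x ♯ f (c h).
  move=> h; have [Gc|] := pselect (G (c h)); last by exists 0.
  by have [b ba ->] := diconjE (lm_sub monG Gc); exists b.
apply: (square_bracket_mem (b := b) (c := fun h => f (c h))) => //.
- exact: sub_closed.
- exact: derivative_lproj.
- by rewrite c0.
- near=> h; have Gc : G (c h) by near: h; exact: tangent_near cI.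
  have [bc bx] := bP _ Gc; split=> //.
  by rewrite -bx; exact: Vax.
Unshelve. all: by end_near. Qed.

Lemma angle_bracket_group0 x w : TO w -> angle_bracket T x w = 0.
Proof.
move=> /tangent_group_lproj0 fw.
by rewrite angle_bracketE fw /square_bracket linear0r linear0l subr0.
Qed.

Lemma angle_bracketDr x y z :
  angle_bracket T x (y + z) = angle_bracket T x y + angle_bracket T x z.
Proof. by rewrite /angle_bracket linearDr linearDl /= opprD addrACA. Qed.

(** Kept general in [V] to be applied both to the local part and to the whole tangent-like space. *)
Lemma angle_bracket_like V x : subspace V -> V x ->
    (forall a, G a -> V (diconj T a x)) -> forall y, L y ->
  V (angle_bracket T x y).
Proof.
move=> sV Vx Vax; apply: tangent_like_ind => /=.
- by rewrite /angle_bracket linear0r linear0l subr0; exact: (subspace0 sV).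
- by move=> y z Vy Vz; rewrite /= angle_bracketDr; exact: (subspaceD sV).
- by move=> w Ow /=; rewrite angle_bracket_group0 //; exact: (subspace0 sV).
- by move=> op Dop y yop; exact: angle_bracket_mem sV Dop Vx Vax yop.
Qed.

Lemma angle_bracket_group_mem w y : TO w -> L y -> TO (angle_bracket T w y).
Proof.
move=> Ow; apply: angle_bracket_like => //; first exact: tangent_group_subspace.
(* Diconjugation fixes 1 and preserves [Omega], so it carries curves in [Omega] through 1 to such
   curves. *)
move=> a Ga; have a1 : diconj T a one = one.
  by have [b ba ->] := diconjE (lm_sub monG Ga); rewrite sharp_one.
rewrite /tangent_group -a1.
by apply: (diconj_tangent Ga) Ow => x; exact: lm_Om_diconj monG _ _ Ga.
Qed.

Lemma angle_bracket_like_mem x y : L x -> L y -> L (angle_bracket T x y).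
Proof.
move=> + Ly; move: x.
apply: (tangent_like_ind (P := [set x | L (angle_bracket T x y)])) => /=.
- rewrite /angle_bracket linear0r linear0l subr0.
  exact: subspace0 tangent_like_subspace.
- move=> x z Lx Lz; rewrite /angle_bracket linearDr linearDl /= opprD addrACA.
  exact: tangent_likeD.
- by move=> w Ow /=; apply: tangent_group_like; exact: angle_bracket_group_mem.
- move=> op Dop x xop /=.
  apply: angle_bracket_like => //; first exact: tangent_like_subspace.
    exact: tangent_op_like xop.
  (* The diconjugate of [x] may be tangent for another operation [op']; this is why the stable
     subspace is the full sum. *)
  move=> a Ga; move: xop; have [p [_ -> _ pD] xp] := tangent_opP Dop.
  have [op' Dop' sub] := pD _ Ga; apply: (tangent_op_like Dop'); apply: sub.
  by apply: (diconj_tangent Ga) xp => z; exact: lm_diconj monG _ _ Ga.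
Qed.

(** Here the curve in [Omega] conjugates directly: conjugation by an element of the group [Omega]
    preserves [Omega] and fixes 1, hence maps the local part into itself. *)
Lemma square_bracket_group_mem v w : TO v -> TO w -> TO (square_bracket T v w).
Proof.
move=> Ov [I [c [cI c0 cw]]].
have [Omul _ O1 _ Oinv] := lm_Om_group monG.
have /choice[b bP] : forall h, exists b, Omega (c h) ->
    Omega b /\ b ♯ c h = one.
  move=> h; have [/Oinv[b Ob [_ bc]]|] := pselect (Omega (c h)); last by exists 0.
  by exists b.
apply: (square_bracket_mem (b := b) (c := c)) => //.
- by apply: sub_closed; exact: tangent_group_subspace.
- exact: tangent_group_subspace.
- near=> h; have Oc : Omega (c h) by near: h; exact: tangent_near cI.
  have [Ob bc] := bP _ Oc; split=> //.
  have b1c : b h ♯ one ♯ c h = one by rewrite sharp_one.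
  rewrite /tangent_group -[X in tangent_at _ _ X]b1c.
  apply: (tangent_at_map (g := fun x => b h ♯ x ♯ c h)) Ov.
    by move=> g t u; exact: derivative_conj.
  by move=> x Ox; apply: (Omul) => //; exact: Omul.
Unshelve. all: by end_near. Qed.

Lemma tangent_like_local_Leibniz :
  local_Leibniz (V := restrict_scalars iota A) L TO
    (angle_bracket T) (square_bracket T).
Proof.
split.
- exact: tangent_like_subspace.
- exact: tangent_group_subspace.
- exact: tangent_group_like.
- split; first exact: angle_bracket_like_mem.
    (* Real scaling by [r] is by definition scaling by [iota r], so bilinearity over [K] applies. *)
    move=> r x y z _ _ _; rewrite !angle_bracketE; exact: (square_bracketPl T (iota r)).
  move=> r x y z _ _ _; rewrite !angle_bracketE.
  have -> : f (r *: x + y : restrict_scalars iota A) = iota r *: f x + f y.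
    exact: linearPr.
  exact: (square_bracketPr T (iota r)).
- by move=> x y z _ _ _; exact: (angle_bracket_Leibniz T x y z).
- by move=> x w _; exact: angle_bracket_group0.
- exact: angle_bracket_group_mem.
- split; first exact: square_bracket_group_mem.
    by move=> r x y z _ _ _; exact: (square_bracketPl T (iota r)).
  by move=> r x y z _ _ _; exact: (square_bracketPr T (iota r)).
- by move=> x y z _ _ _; exact: (square_bracket_Jacobi T x y z).
- by move=> x y _ _; exact: (square_bracketN T x y).
- by move=> x y z _ _ _; exact: (square_angle_Hu_Liu T x y z).
Qed.

End Tangents.
End LocalMonoid.

(** * Specialization to real and complex scalars *)

Lemma scalar_emb_real_embedding (R : realType) (k : scalars) :
  real_embedding (scalar_emb R k).
Proof.
case: k; split => //=.
- by move=> x _; exists x.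
- exact: complex.lecR.
(* In the order of [R[i]], a nonnegative number has zero imaginary part. *)
- move=> [a b]; rewrite complex.lecE /= => /andP[/eqP -> _].
  by exists a.
Qed.

(** Two real coordinates in either case: real and imaginary part over [R[i]], the identity twice
    over [R]. *)
Lemma scalar_coordinates (R : realType) (k : scalars) :
  exists phi : bool -> scalar_field R k -> R,
    (forall i r x y, phi i (scalar_emb R k r * x + y) = r * phi i x + phi i y) /\
    (forall x, (forall i, phi i x = 0) -> x = 0).
Proof.
case: k => /=; first by exists (fun=> id); split=> // x /(_ true).
exists (fun i x => if i then complex.Re x else complex.Im x); split.
  by case=> r [a b] [c d] /=; rewrite mul0r ?subr0 ?addr0.
by move=> [a b] ab0; have /= -> := ab0 true; have /= -> := ab0 false.
Qed.

Lemma finite_dimensional_subspace_closed (R : realType) (k : scalars)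
    (A : normedModType (scalar_field R k)) (V : set A) :
  finite_dimensional A ->
  is_subspace (V := restrict_scalars (scalar_emb R k) A) V -> closed V.
Proof.
move=> [n [v2r [v2rL v2r_bij]]] sV.
have [phi [phiL phi0]] := scalar_coordinates R k.
(* The real coordinates of the coordinates of [x]: finitely many functionals that separate the
   points of [A]. *)
pose psi (ij : 'I_n * bool) (x : A) := phi ij.2 (v2r x ord0 ij.1).
apply: (subspace_closed (scalar_emb_real_embedding R k) (phi := psi)
  (s := index_enum _)) sV _.
  by move=> [i j] r x y; rewrite /psi v2rL !mxE phiL.
move=> x _ x0; apply: (bij_inj v2r_bij).
have -> : v2r 0 = 0.
  by have := v2rL (-1) 0 0; rewrite scaler0 addr0 scaleN1r addNr.
apply/rowP => i; rewrite mxE; apply: phi0 => j.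
exact: (x0 (i, j) (mem_index_enum _)).
Qed.
Unset Implicit Arguments.

Theorem proposition3p1 (R : realType) (k : scalars)
    (A : completeNormedModType (scalar_field R k)) (T : seven_tuple A)
    (finA : finite_dimensional A)
    (sharp_cont : continuous (fun p : A * A => sharp T p.1 p.2))
    (lprod_cont : continuous (fun p : A * A => lprod T p.1 p.2))
    (rprod_cont : continuous (fun p : A * A => rprod T p.1 p.2))
    (Delta : set (A -> A -> A)) (Omega G : set A)
    (monG : local_monoid T Delta Omega G) :
  local_Leibniz (V := restrict_scalars (scalar_emb R k) A)
    (tangent_like (scalar_emb R k) T Delta Omega G)
    (tangent_group (scalar_emb R k) T Omega)
    (angle_bracket T) (square_bracket T) /\
  tangent_group (scalar_emb R k) T Omega `<=` additive_halo T.
Proof.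
have iotaP := scalar_emb_real_embedding R k.
(* Finite dimensionality enters through the closedness of real subspaces. *)
have clV V : is_subspace (V := restrict_scalars (scalar_emb R k) A) V -> closed V.
  exact: finite_dimensional_subspace_closed.
split; first exact: tangent_like_local_Leibniz.
move=> w Ow; apply: additive_haloE.
exact: (tangent_group_lproj0 iotaP lprod_cont clV monG Ow).
Qed.
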